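(* Let $\mathbb{F}_q$ be a finite field, let $r,s\ge 1$ be integers with $r\le q$, let $\alpha_1,\ldots,\alpha_r\in\mathbb{F}_q$ be pairwise distinct, $\mathcal{A}=\{\alpha_1,\ldots,\alpha_r\}$, let $V=(v_{i,j})\in(\mathbb{F}_q^\ast)^{s\times r}$, and let $0\le k\le rs$. Let $C=\operatorname{HRS}_k(\mathcal{A},V,s,r)$ and set $N=rs$. For $1\le j\le r$ put $A_j(x)=\prod_{\ell\neq j}(x-\alpha_\ell)^s$. For every polynomial $g\in\mathcal{P}_{<N-k}$ define the matrix $W(g)=(w_{i,j}(g))\in\operatorname{Mat}_{s\times r}(\mathbb{F}_q)$ by \[ w_{i,j}(g)=\frac{1}{v_{i,j}}\,\partial^{(s-i)}\!\left(\frac{g(x)}{A_j(x)}\right)\bigg|_{x=\alpha_j},\qquad 1\le i\le s,\ 1\le j\le r. \] Then the Euclidean dual code is \[ C^\perp=\{W(g): g\in\mathcal{P}_{<N-k}\}. \]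
   Context: For an integer $h\ge 0$, $\mathcal{P}_{<h}=\{f\in\mathbb{F}_q[x]:\deg f<h\}$, with $\mathcal{P}_{<0}=\{0\}$. Hasse derivative (hyperderivative): for $f(x)=\sum_\ell f_\ell x^\ell\in\mathbb{F}_q[x]$ and $j\ge0$, $\partial^{(j)}f(x)=\sum_{\ell}\binom{\ell}{j}f_\ell x^{\ell-j}$ (with $\binom{\ell}{j}=0$ if $j>\ell$, binomials reduced modulo the characteristic). Equivalently $f(x)=\sum_{j\ge0}\partial^{(j)}f(u)(x-u)^j$ for every $u\in\mathbb{F}_q$. For a rational function $\phi\in\mathbb{F}_q(x)$ regular at $u$, $\partial^{(j)}\phi(x)|_{x=u}$ denotes the coefficient of $(x-u)^j$ in the power series expansion of $\phi$ at $u$. Hyperderivative Reed–Solomon (HRS) code: for $0\le k\le rs$, \[ \operatorname{HRS}_k(\mathcal{A},V,s,r)=\left\{\bigl(v_{i,j}\,\partial^{(i-1)}f(\alpha_j)\bigr)_{1\le i\le s,\,1\le j\le r}: f\in\mathcal{P}_{<k}\right\}\subseteq\operatorname{Mat}_{s\times r}(\mathbb{F}_q). \] Euclidean inner product on $\operatorname{Mat}_{s\times r}(\mathbb{F}_q)$: $\langle A,B\rangle=\sum_{i=1}^s\sum_{j=1}^r a_{i,j}b_{i,j}$; the Euclidean dual of a linear code $C$ is $C^\perp=\{B\in\operatorname{Mat}_{s\times r}(\mathbb{F}_q):\langle A,B\rangle=0\text{ for all }A\in C\}$. *)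

(* Defs.v *)
From HB Require Import structures.
From mathcomp Require Import all_boot all_order all_algebra.

Set Implicit Arguments.
Unset Strict Implicit.
Unset Printing Implicit Defensive.

Import GRing.Theory.
Local Open Scope ring_scope.

Notation "x %:F" := (@FracField.tofrac _ x) : ring_scope.

Section PowerSeriesQuotient.
Variable F : fieldType.
Implicit Types (a b : nat -> F) (m : nat).

(* The first m coefficients of the power series quotient a / b, b 0 != 0, a
   power series being identified with its sequence of coefficients: the c_m are
   obtained by solving a_m = \sum_(i <= m) c_i b_(m-i) for c_m.  The defining
   identity is [pquotP]. *)
Fixpoint pquot_seq a b m : seq F :=
  if m is m'.+1 then
    let c := pquot_seq a b m' in
    rcons c ((a m' - \sum_(i < m') c`_i * b (m' - i)%N) / b 0)
  else [::].

Definition pquot a b m : F := (pquot_seq a b m.+1)`_m.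

Lemma size_pquot_seq a b m : size (pquot_seq a b m) = m.
Proof. by elim: m => //= m IHm; rewrite size_rcons IHm. Qed.

Lemma nth_pquot_seq a b m i : (i < m)%N -> (pquot_seq a b m)`_i = pquot a b i.
Proof.
elim: m => // m IHm; rewrite ltnS leq_eqVlt => /orP[/eqP->//|lt_im].
by rewrite /= nth_rcons size_pquot_seq lt_im IHm.
Qed.

Lemma pquotP a b m : b 0 != 0 ->
  \sum_(i < m.+1) pquot a b i * b (m - i)%N = a m.
Proof.
move=> b0; rewrite big_ord_recr /= subnn {2}/pquot /=.
rewrite nth_rcons size_pquot_seq ltnn eqxx divfK // addrC.
rewrite (eq_bigr (fun i : 'I_m => pquot a b i * b (m - i)%N)) ?subrK //.
by move=> i _; rewrite nth_pquot_seq.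
Qed.

End PowerSeriesQuotient.

Section RationalFunctions.
Variable F : fieldType.
Implicit Types (phi : {fraction {poly F}}) (p n d : {poly F}) (u : F).

(* A numerator and a denominator of phi in lowest terms. *)
Definition rat_num phi : {poly F} :=
  \n_(repr phi) %/ gcdp \n_(repr phi) \d_(repr phi).
Definition rat_den phi : {poly F} :=
  \d_(repr phi) %/ gcdp \n_(repr phi) \d_(repr phi).

(* The coefficient of (x - u)^j in the power series expansion of phi at u,
   where phi is regular at u, i.e. (rat_den phi).[u] != 0 (if phi has a pole at
   u the value is meaningless); p^`N(i).[u] is the coefficient of (x - u)^i in
   the expansion of the polynomial p. *)
Definition rhasse (j : nat) phi u : F :=
  pquot (fun i => (rat_num phi)^`N(i).[u]) (fun i => (rat_den phi)^`N(i).[u]) j.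

Lemma rat_numden phi :
  [/\ rat_den phi != 0, coprimep (rat_num phi) (rat_den phi)
    & phi = (rat_num phi)%:F / (rat_den phi)%:F].
Proof.
set n := \n_(repr phi); set d := \d_(repr phi).
have d0 : d != 0 by exact: denom_ratioP.
have g0 : gcdp n d != 0 by rewrite gcdp_eq0 negb_and d0 orbT.
have en : rat_num phi * gcdp n d = n by rewrite divpK ?dvdp_gcdl.
have ed : rat_den phi * gcdp n d = d by rewrite divpK ?dvdp_gcdr.
split.
- by apply: contraNneq d0 => h; rewrite -ed h mul0r.
- by apply: coprimep_div_gcd; rewrite d0 orbT.
have rd0 : rat_den phi != 0 by apply: contraNneq d0 => h; rewrite -ed h mul0r.
have e : phi * d%:F = n%:F.
  rewrite -[phi]reprK; unlock FracField.tofrac.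
  rewrite -[LHS]FracField.pi_mul; apply/eqP; rewrite FracField.equivf_def.
  rewrite /FracField.mulf /= !numden_Ratio ?oner_eq0 ?mulf_neq0 ?oner_neq0 //.
  by rewrite !mulr1 mulrC.
have tg0 : (gcdp n d)%:F != 0 by rewrite tofrac_eq0.
have td0 : (rat_den phi)%:F != 0 by rewrite tofrac_eq0.
apply: (canRL (mulfK td0)); apply: (mulIf tg0).
by rewrite -mulrA -!tofracM en ed.
Qed.

Lemma coef_shift p u i : (p \Po ('X + u%:P))`_i = p^`N(i).[u].
Proof.
have e : p \Po ('X + u%:P) = \poly_(i < size p) p^`N(i).[u].
  rewrite /comp_poly addrC nderiv_taylor; last exact: mulrC.
  rewrite size_map_polyC poly_def; apply: eq_bigr => j _.
  by rewrite nderivn_map horner_map /= mul_polyC.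
rewrite e coef_poly; case: ltnP => // h.
by rewrite nderivn_poly0 ?horner0.
Qed.

(* rhasse does not depend on the fraction chosen: its values are the
   coefficients of the power series c with d * c = n for every n / d = phi whose
   denominator does not vanish at u. *)
Lemma rhasseP n d u m : d.[u] != 0 ->
  \sum_(i < m.+1) rhasse i (n%:F / d%:F) u * d^`N(m - i).[u] = n^`N(m).[u].
Proof.
move=> du; set phi := _ / _; have [D0 cND ephi] := rat_numden phi.
set N := rat_num phi in ephi cND *; set D := rat_den phi in D0 ephi cND *.
have d0 : d != 0 by apply: contraNneq du => ->; rewrite horner0.
have e : n * D = d * N.
  apply/eqP; rewrite -tofrac_eq !tofracM; apply/eqP.
  have t1 : d%:F != 0 by rewrite tofrac_eq0.
  have t2 : D%:F != 0 by rewrite tofrac_eq0.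
  have h1 : phi * d%:F = n%:F by exact: (divfK t1).
  have h2 : phi * D%:F = N%:F
    by exact: etrans (congr1 (fun x => x * D%:F) ephi) (divfK t2 _).
  by rewrite -h1 -h2 mulrAC mulrC.
have Du : D.[u] != 0.
  have : D %| d.
    by rewrite -(@Gauss_dvdpl _ d N D) 1?coprimep_sym // -e dvdp_mull.
  by case/dvdpP => k dk; move: du; rewrite dk hornerM mulf_eq0 negb_or => /andP[].
pose sh p := p \Po ('X + u%:P).
pose C := \poly_(i < m.+1) rhasse i phi u.
have conv p k : (k <= m)%N ->
    (C * sh p)`_k = \sum_(i < k.+1) rhasse i phi u * p^`N(k - i).[u].
  move=> km; rewrite coefM; apply: eq_bigr => i _.
  by rewrite coef_poly coef_shift (leq_trans (ltn_ord i)).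
have small p : (forall k, (k <= m)%N -> p`_k = 0) -> 'X^(m.+1) %| p.
  move=> h; rewrite -(poly_take_drop m.+1 p).
  rewrite (_ : take_poly _ _ = 0) ?add0r ?dvdp_mull //; apply/polyP => k.
  by rewrite coef_take_poly coef0; case: ltnP => // /h.
have hD : 'X^(m.+1) %| C * sh D - sh N.
  apply: small => k km; rewrite coefB conv // coef_shift.
  rewrite [X in X - _](_ : _ = N^`N(k).[u]) ?subrr //.
  by apply: (@pquotP _ _ (fun i => D^`N(i).[u])); rewrite nderivn0.
have : 'X^(m.+1) %| C * sh d - sh n.
  rewrite -(@Gauss_dvdpr _ _ (sh D)); last first.
    apply: coprimep_expl; rewrite coprimep_sym -['X]subr0 -(polyC0 F).
    by rewrite coprimep_XsubC /root horner_coef0 coef_shift nderivn0.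
  rewrite (_ : _ * _ = sh d * (C * sh D - sh N)) ?dvdp_mull //.
  have he : sh n * sh D = sh d * sh N by rewrite /sh -!comp_polyM e.
  by rewrite !mulrBr -he [sh n * _]mulrC [sh D * (C * _)]mulrC mulrAC [_ * sh d]mulrC.
case/dvdpP => k hk; have := congr1 (fun p : {poly F} => p`_m) hk.
rewrite coefB conv // coef_shift coefMXn leqnn => /eqP.
by rewrite subr_eq0 => /eqP.
Qed.

End RationalFunctions.

Section HRS.
Variables (F : finFieldType) (s r : nat).
Implicit Types (alpha : 'I_r -> F) (V : 'M[F]_(s, r)).

(* Rows and columns are indexed from 0: the entry of the 0-based row i involves
   the hyperderivative of order i, and {poly_k F} is the set of polynomials of
   degree < k (only 0 if k = 0). *)
Definition hrs_word alpha V (f : {poly F}) : 'M[F]_(s, r) :=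
  \matrix_(i < s, j < r) (V i j * f^`N(i).[alpha j]).

Definition HRS alpha V (k : nat) : {set 'M[F]_(s, r)} :=
  [set hrs_word alpha V f | f : {poly_k F}].

Definition mxinner (A B : 'M[F]_(s, r)) : F :=
  \sum_(i < s) \sum_(j < r) A i j * B i j.

Definition euclidean_dual (C : {set 'M[F]_(s, r)}) : {set 'M[F]_(s, r)} :=
  [set B | [forall A in C, mxinner A B == 0]].

Definition cofactor_poly alpha (j : 'I_r) : {poly F} :=
  \prod_(l < r | l != j) ('X - (alpha l)%:P) ^+ s.

(* With the 0-based i, the order s - i of the 1-based i reads s - i.+1. *)
Definition dual_word alpha V (g : {poly F}) : 'M[F]_(s, r) :=
  \matrix_(i < s, j < r)
    ((V i j)^-1 *
     rhasse (s - i.+1) (g%:F / (cofactor_poly alpha j)%:F) (alpha j)).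

End HRS.

(* Main.v *)
(* By Hermite interpolation, c |-> \sum_j c_j A_j is a bijection from families
   of r polynomials of degree < s onto the polynomials of degree < N = rs, and
   c_j is the truncated expansion at alpha_j of h / A_j, for h the image of c.
   Comparing the coefficients of x^(N-1) gives the residue formula
     \sum_j [(x - alpha_j)^(s-1)] (h / A_j) = [x^(N-1)] h   for deg h < N.
   Since v_ij cancels, <HRS word of f, W(g)> is the left-hand side for h = f g,
   by the Leibniz rule, so it vanishes when deg (f g) < N - 1.  Conversely every
   matrix is W(g) for some g with deg g < N; if d = deg g >= N - k, then
   pairing with f = x^(N-1-d) gives the leading coefficient of g, so W(g) is
   not in the dual. *)
Require Import Defs.
From mathcomp Require Import all_boot all_order all_algebra.
From mathcomp Require Import zify.

(** * Hasse derivatives and truncated expansions at a point *)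

Section HasseDerivatives.

Set Implicit Arguments.
Unset Strict Implicit.
Import GRing.Theory.
Local Open Scope ring_scope.

Variable F : fieldType.
Implicit Types (p q n d c : {poly F}) (u : F).

Lemma nderivnM_horner p q m u :
  (p * q)^`N(m).[u] = \sum_(i < m.+1) p^`N(i).[u] * q^`N(m - i).[u].
Proof.
rewrite -coef_shift comp_polyM coefM.
by apply: eq_bigr => i _; rewrite !coef_shift.
Qed.

(** Translating by [u] moves the question to divisibility by X^m, that is, to the lowest [m]
    coefficients. *)
Lemma dvdp_XsubC_expP u m p :
  reflect (forall i, (i < m)%N -> p^`N(i).[u] = 0) (('X - u%:P) ^+ m %| p).
Proof.
apply: (iffP idP) => [/dvdpP[k ->] i lt_im | p0].
  rewrite -coef_shift comp_polyM rmorphXn /= comp_polyB comp_polyX comp_polyC.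
  by rewrite addrK coefMXn lt_im.
rewrite -[p](comp_polyXaddC_K _ u) -(poly_take_drop m (p \Po _)).
rewrite (_ : take_poly _ _ = 0) ?add0r.
  by rewrite comp_polyM comp_Xn_poly dvdp_mull.
apply/polyP => i; rewrite coef_take_poly coef0; case: ltnP => // /p0.
by rewrite coef_shift.
Qed.

Lemma nderivn_horner_top m p u :
  (size p <= m.+1)%N -> p^`N(m).[u] = p`_m.
Proof.
move=> sp; rewrite (@size1_polyC _ p^`N(m)).
  by rewrite hornerC coef_nderivn addn0 binn mulr1n.
apply/leq_sizeP => i i1; rewrite coef_nderivn.
by rewrite (leq_sizeP _ _ sp) ?mul0rn // -addn1 leq_add2l.
Qed.

Definition taylor_poly u m (c : nat -> F) : {poly F} :=
  (\poly_(i < m) c i) \Po ('X - u%:P).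

Lemma size_taylor_poly u m (c : nat -> F) : (size (taylor_poly u m c) <= m)%N.
Proof. by rewrite size_comp_poly2 ?size_XsubC ?size_poly. Qed.

Lemma nderivn_taylor_poly u m (c : nat -> F) i : (i < m)%N ->
  (taylor_poly u m c)^`N(i).[u] = c i.
Proof.
move=> lt_im; rewrite -coef_shift -comp_polyA comp_polyB comp_polyX comp_polyC.
by rewrite addrK comp_polyXr coef_poly lt_im.
Qed.

Lemma rhasse_dvdp u m n d : d.[u] != 0 ->
  ('X - u%:P) ^+ m %|
    n - taylor_poly u m (fun i => rhasse i (n%:F / d%:F) u) * d.
Proof.
move=> du; apply/dvdp_XsubC_expP => i lt_im.
rewrite nderivnB hornerD hornerN nderivnM_horner -(rhasseP n i du).
apply/eqP; rewrite subr_eq0; apply/eqP/eq_bigr => j _.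
by rewrite nderivn_taylor_poly // (leq_trans (ltn_ord j)).
Qed.

(** As [d] is invertible modulo (X - u)^m, the congruence n = c d has a single solution there.
    Expansions are computed below by exhibiting such a [c]. *)
Lemma rhasse_unique u m n d c : d.[u] != 0 -> ('X - u%:P) ^+ m %| n - c * d ->
  forall i, (i < m)%N -> rhasse i (n%:F / d%:F) u = c^`N(i).[u].
Proof.
move=> du dvd_c i lt_im; rewrite -(nderivn_taylor_poly u
  (fun i => rhasse i (n%:F / d%:F) u) lt_im).
set t := taylor_poly _ _ _.
have : ('X - u%:P) ^+ m %| (t - c) * d.
  rewrite (_ : _ * d = (n - c * d) - (n - t * d)); last first.
    by rewrite mulrBl opprB [RHS]addrC addrA subrK.
  by rewrite dvdp_sub // rhasse_dvdp.
rewrite Gauss_dvdpl; last first.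
  by rewrite coprimep_expl // coprimep_sym coprimep_XsubC.
move/dvdp_XsubC_expP/(_ i lt_im)/eqP.
by rewrite nderivnB hornerD hornerN subr_eq0 => /eqP.
Qed.

(** Multiplying the truncated expansion of n / d by [p] solves the congruence for p n / d, so the
    Leibniz rule for polynomials carries over. *)
Lemma rhasseM u m p n d : d.[u] != 0 ->
  rhasse m ((p * n)%:F / d%:F) u =
  \sum_(i < m.+1) p^`N(i).[u] * rhasse (m - i) (n%:F / d%:F) u.
Proof.
move=> du; pose t := taylor_poly u m.+1 (fun i => rhasse i (n%:F / d%:F) u).
rewrite (@rhasse_unique u m.+1 _ _ (p * t)) // ?nderivnM_horner.
  by apply: eq_bigr => i _; rewrite nderivn_taylor_poly // ltnS leq_subr.
by rewrite -mulrA -mulrBr dvdp_mull // rhasse_dvdp.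
Qed.

Lemma coefM_top p q a b : (size p <= a.+1)%N -> (size q <= b.+1)%N ->
  (p * q)`_(a + b) = p`_a * q`_b.
Proof.
move=> sp sq; have lt_a : (a < (a + b).+1)%N by rewrite ltnS leq_addr.
rewrite coefM (bigD1 (Ordinal lt_a)) //= addKn big1 ?addr0 // => i.
rewrite -val_eqE neq_ltn /= => /orP[lt_ia | lt_ai].
  by rewrite [q`_ _](leq_sizeP _ _ sq) ?mulr0 // ltn_subRL ltn_add2r.
by rewrite (leq_sizeP _ _ sp) ?mul0r.
Qed.

Lemma prod_dvdp (I : eqType) (e : seq I) (f : I -> {poly F}) p :
  uniq e -> (forall i j, i != j -> coprimep (f i) (f j)) ->
  (forall i, f i %| p) -> \prod_(i <- e) f i %| p.
Proof.
move=> + cop dvd; elim: e => [|i e IHe] /=; first by rewrite big_nil dvd1p.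
case/andP=> ie /IHe dvd_e; rewrite big_cons Gauss_dvdp ?dvd //.
rewrite big_seq; apply: (big_ind (coprimep (f i))) => [|x y|j je].
- exact: coprimep1.
- by rewrite coprimepMr => -> ->.
- by apply: cop; apply: contraNneq ie => ->.
Qed.

End HasseDerivatives.

(** * Hermite interpolation and the residue formula *)

Section Duality.

Set Implicit Arguments.
Unset Strict Implicit.
Import GRing.Theory.
Local Open Scope ring_scope.

Variables (F : finFieldType) (r s : nat).
Hypotheses (r_gt0 : (1 <= r)%N) (s_gt0 : (1 <= s)%N).
Variable alpha : 'I_r -> F.
Hypothesis alpha_inj : injective alpha.
Implicit Types (f g h : {poly F}) (V : 'M[F]_(s, r)).

Local Notation A := (cofactor_poly s alpha).

Lemma monic_cofactor_poly j : A j \is monic.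
Proof. by apply: monic_prod => l _; rewrite monic_exp // monicXsubC. Qed.

Lemma size_cofactor_poly j : size (A j) = (r.-1 * s).+1.
Proof.
rewrite size_prod; last by move=> l _; rewrite expf_neq0 // polyXsubC_eq0.
under eq_bigr do rewrite size_exp_XsubC.
by rewrite sum_nat_const cardC1 card_ord mulnS subSn ?leq_addr // addKn.
Qed.

Lemma horner_cofactor_poly j : (A j).[alpha j] != 0.
Proof.
rewrite horner_prod; apply/prodf_neq0 => l neq_lj.
by rewrite horner_exp expf_neq0 // hornerXsubC subr_eq0 inj_eq // eq_sym.
Qed.

Lemma dvdp_cofactor_poly j l : l != j -> ('X - (alpha l)%:P) ^+ s %| A j.
Proof. by move=> neq_lj; rewrite /cofactor_poly (bigD1 l) //= dvdp_mulr. Qed.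

Lemma size_hermite_sum (c : 'I_r -> {poly F}) :
  (forall j, size (c j) <= s)%N ->
  (size (\sum_(j < r) c j * A j)%R <= r * s)%N.
Proof.
move=> sc; apply: (leq_trans (size_sum _ _ _)); apply/bigmax_leqP => j _.
apply: (leq_trans (size_polyMleq _ _)); rewrite size_cofactor_poly addnS /=.
by rewrite -[X in (_ <= X * _)%N](prednK r_gt0) mulSn leq_add2r.
Qed.

Lemma dvdp_hermite_sum (c : 'I_r -> {poly F}) j :
  ('X - (alpha j)%:P) ^+ s %| \sum_(l < r) c l * A l - c j * A j.
Proof.
rewrite (bigD1 j) //= [_ + _ - _]addrC addKr.
apply: (big_ind (dvdp (('X - (alpha j)%:P) ^+ s))) => [|p q|l neq_lj].
- exact: dvdp0.
- exact: dvdp_add.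
- by rewrite dvdp_mull // dvdp_cofactor_poly // eq_sym.
Qed.

(** The pairwise coprime powers (X - alpha_j)^s have a product of degree r s, too large to divide a
    nonzero [h]. *)
Lemma size_hermite_eq0 h : (size h <= r * s)%N ->
  (forall j, ('X - (alpha j)%:P) ^+ s %| h) -> h = 0.
Proof.
move=> sh dvd_h; apply/eqP; apply: contraTT sh => h0; rewrite -ltnNge.
have dvd_prod : \prod_(j < r) ('X - (alpha j)%:P) ^+ s %| h.
  apply: prod_dvdp => // [|i j neq_ij]; first exact: index_enum_uniq.
  rewrite coprimep_expl ?coprimep_expr // coprimep_XsubC2 // subr_eq0.
  by rewrite inj_eq // eq_sym.
apply: leq_trans (dvdp_leq h0 dvd_prod).
rewrite size_prod; last by move=> l _; rewrite expf_neq0 // polyXsubC_eq0.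
under eq_bigr do rewrite size_exp_XsubC.
by rewrite sum_nat_const card_ord mulnS subSn ?leq_addr // addKn.
Qed.

Definition hermite_part h j : {poly F} :=
  taylor_poly (alpha j) s (fun i => rhasse i (h%:F / (A j)%:F) (alpha j)).

(** Modulo (X - alpha_j)^s only the j-th summand survives, and it agrees with [h] there;
    [size_hermite_eq0] then kills the difference. *)
Lemma hermite_sumE h : (size h <= r * s)%N ->
  h = \sum_(j < r) hermite_part h j * A j.
Proof.
move=> sh; apply/eqP; rewrite -subr_eq0; apply/eqP/size_hermite_eq0 => [|j].
  rewrite (leq_trans (size_polyD _ _)) // size_polyN geq_max sh.
  by apply: size_hermite_sum => j; apply: size_taylor_poly.
set S := \sum_(l < r) _.
rewrite -(subrKA (hermite_part h j * A j) h) -[_ - S]opprB dvdp_sub //.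
  by rewrite rhasse_dvdp // horner_cofactor_poly.
exact: dvdp_hermite_sum.
Qed.

(** Since A_j is monic of degree (r - 1) s, position r s - 1 = (s - 1) + (r - 1) s of the j-th
    summand reads the coefficient s - 1 of [hermite_part h j]. *)
Lemma sum_residues h : (size h <= r * s)%N ->
  \sum_(j < r) rhasse s.-1 (h%:F / (A j)%:F) (alpha j) = h`_(r * s).-1.
Proof.
move=> sh; rewrite [in RHS](hermite_sumE sh) coef_sum; apply: eq_bigr => j _.
have st : (size (hermite_part h j) <= s.-1.+1)%N.
  by rewrite (prednK s_gt0) size_taylor_poly.
have -> : ((r * s).-1 = s.-1 + r.-1 * s)%N.
  by case: r s r_gt0 s_gt0 => [|r'] // [|s'] // _ _; rewrite mulSn.
rewrite coefM_top // ?size_cofactor_poly //.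
have := monicP (monic_cofactor_poly j).
rewrite lead_coefE size_cofactor_poly /= => ->.
by rewrite mulr1 -(nderivn_horner_top (alpha j) st) nderivn_taylor_poly ?prednK.
Qed.

(** * Pairing code words with dual words *)

Variable V : 'M[F]_(s, r).
Hypothesis V_neq0 : forall i j, V i j != 0.

Lemma mxinner_dual_word f g : (size (f * g)%R <= r * s)%N ->
  mxinner (hrs_word alpha V f) (dual_word alpha V g) = (f * g)`_(r * s).-1.
Proof.
move=> sfg; rewrite -sum_residues // /mxinner exchange_big /=.
(* Cancelling [V] leaves the Leibniz sum of order s - 1 for f g / A_j, whose index s - 1 - i is the
   [s - i.+1] of [dual_word]. *)
apply: eq_bigr => j _; rewrite rhasseM ?horner_cofactor_poly // prednK //.
apply: eq_bigr => i _; rewrite !mxE -[V i j * _]mulrC -mulrA mulVKf //.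
by rewrite -subn1 -subnDA add1n.
Qed.

Lemma dual_word_surj (B : 'M[F]_(s, r)) :
  exists2 g : {poly F}, (size g <= r * s)%N & dual_word alpha V g = B.
Proof.
(* These are the Taylor coefficients to prescribe at alpha_j: they undo the row reversal and the
   division by [V] in [dual_word]. [insub] succeeds because s > 0. *)
pose e i j := odflt 0 (omap (fun i' => V i' j * B i' j) (insub (s - i.+1)%N)).
pose c j := taylor_poly (alpha j) s (e^~ j).
exists (\sum_(j < r) c j * A j).
  by apply: size_hermite_sum => j; apply: size_taylor_poly.
apply/matrixP => i j; rewrite mxE.
have lt_i : (s - i.+1 < s)%N by rewrite ltn_subrL s_gt0.
rewrite (rhasse_unique (horner_cofactor_poly j) (dvdp_hermite_sum c j)) //.
by rewrite nderivn_taylor_poly // /e subnSK // subKn 1?ltnW // valK /= mulKf.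
Qed.

End Duality.

Theorem theorem8 (F : finFieldType) (r s : nat)
    (r_gt0 : (1 <= r)%N) (s_gt0 : (1 <= s)%N) (r_le_q : (r <= #|F|)%N)
    (alpha : 'I_r -> F) (alpha_inj : injective alpha)
    (V : 'M[F]_(s, r)) (V_neq0 : forall i j, V i j != 0%R)
    (k : nat) (k_le : (k <= r * s)%N) :
  euclidean_dual (HRS alpha V k) =
  [set dual_word alpha V g | g : {poly_(r * s - k) F}].
Proof.
have N_gt0 : (0 < r * s)%N by rewrite muln_gt0 r_gt0.
apply/setP => B; rewrite inE; apply/forall_inP/imsetP => [dualB | [g _ ->]].
  have [g sg defB] := dual_word_surj r_gt0 s_gt0 alpha_inj V_neq0 B.
  suff sgk : (size g <= r * s - k)%N.
    by exists (npolyp _ g); rewrite ?inE // npolypK.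
  rewrite leqNgt; apply/negP => lt_g.
  have g0 : (0 < size g)%N by apply: leq_ltn_trans lt_g.
  (* Multiplying by X^m moves the leading coefficient of [g] to position r s - 1, and size g > r s -
     k makes m < k. *)
  pose m := (r * s - size g)%N.
  have lt_mk : (m < k)%N by rewrite /m ltn_subLR // addnC -ltn_subLR.
  have smk : (size ('X^m : {poly F})%R <= k)%N by rewrite size_polyXn.
  have /eqP := dualB _ (imset_f _ (isT : npolyp k 'X^m%R \in predT)).
  rewrite npolypK // -defB mxinner_dual_word //; last first.
    by rewrite (leq_trans (size_polyMleq _ _)) // size_polyXn addSn /= subnK.
  rewrite coefXnM ltnNge.
  have -> : ((r * s).-1 - m = (size g).-1)%N by lia.
  rewrite (_ : m <= _)%N /=; last by lia.
  by move/eqP; rewrite -lead_coefE lead_coef_eq0 -size_poly_eq0 eqn0Ngt g0.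
move=> _ /imsetP[f _ ->].
have sf : (size f <= k)%N := valP f.
have sg : (size g <= r * s - k)%N := valP g.
(* The sizes of the factors sum to at most r s, so the product has degree below r s - 1. *)
have sfg : (size (polyn f * polyn g)%R <= (r * s).-1)%N.
  by apply: (leq_trans (size_polyMleq _ _)); lia.
rewrite mxinner_dual_word // ?(leq_sizeP _ _ sfg) //.
exact: leq_trans sfg (leq_pred _).
Qed.
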